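(* Let $X\subset\mathbb Z^n$ be a finite digital image with $c_1$-adjacency, where $n\le4$, and let $f:X\to X$ be continuous with $\bar L(f)\neq0$. Then there is an elementary cube $\sigma\subseteq X$ with $f(\sigma)=\sigma$.
   Context: On $\mathbb Z^n$, the $c_1$-adjacency declares two points adjacent iff they differ by $\pm1$ in exactly one coordinate and agree in all others. Write $x\leftrightarrow y$ for adjacent and $x\Leftrightarrow y$ for adjacent or equal; a map is continuous if $x\leftrightarrow y$ implies $f(x)\Leftrightarrow f(y)$. Cubical homology: an elementary interval is $\{a,a+1\}$ (nondegenerate) or $\{a\}$ (degenerate), $a\in\mathbb Z$; an elementary cube is $\sigma=t_1\times\dots\times t_n$ with each $t_i$ an elementary interval, and its dimension $q$ is the number of nondegenerate factors. $\bar C_q(X)$ is the free abelian group on the elementary $q$-cubes contained in $X$. With $A_i\sigma$ (resp. $B_i\sigma$) obtained by replacing $t_i$ by $\{\min t_i\}$ (resp. $\{\max t_i\}$), and $j_1<\dots<j_q$ the indices of nondegenerate factors, $\partial\sigma=\sum_{i=1}^q(-1)^i(A_{j_i}\sigma-B_{j_i}\sigma)$; $\bar H_q(X)$ is the homology. For continuous $f:X\to X$, define $\bar f_q(\sigma)=0$ if $f(\sigma)$ is not an elementary $q$-cube; otherwise $\tau=f(\sigma)$ is a $q$-cube, and identifying $\sigma$ and $\tau$ with $\{0,1\}^q$ via their nondegenerate coordinates (in increasing order, shifted by their minima), $f|_\sigma$ has the form $(x_1,\dots,x_q)\mapsto(y_1,\dots,y_q)$ with each $y_i\in\{x_{\pi(i)},1-x_{\pi(i)}\}$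 for a permutation $\pi$; set $\bar f_q(\sigma)=\operatorname{sgn}(\pi)(-1)^r\tau$, where $r$ is the number of $i$ with $y_i=1-x_{\pi(i)}$. It is known that for $n\le4$ these $\bar f_q$ form a chain map, inducing $\bar f_{*,q}$ on $\bar H_q(X)$. The cubical Lefschetz number is $\bar L(f)=\sum_{q\ge0}(-1)^q\operatorname{tr}(\bar f_{*,q})$, traces taken on $\bar H_q(X)\otimes\mathbb Q$. *)

(* Defs.v *)
From HB Require Import structures.
From mathcomp Require Import all_boot all_order all_algebra all_fingroup.
From mathcomp Require Import finmap.
Set Implicit Arguments. Unset Strict Implicit. Unset Printing Implicit Defensive.
Import Order.TTheory GRing.Theory Num.Theory.
Local Open Scope fset_scope.
Local Open Scope ring_scope.

Definition pt (n : nat) := {ffun 'I_n -> int}.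

Definition c1adj n (x y : pt n) : Prop :=
  exists i : 'I_n, `|x i - y i|%R = 1%N /\ forall j, j != i -> x j = y j.

Definition c1_continuous n (X : {fset pt n}) (f : pt n -> pt n) : Prop :=
  forall x y, x \in X -> y \in X -> c1adj x y -> f x = f y \/ c1adj (f x) (f y).

(* An elementary cube is encoded by (a, e): a is its minimal vertex and e the
   set of nondegenerate coordinates; t_i = {a_i, a_i+1} if i \in e, {a_i} else. *)
Definition cube n := (pt n * {set 'I_n})%type.

Definition elist n (e : {set 'I_n}) : seq 'I_n := [seq i <- enum 'I_n | i \in e].

Definition xb q (x : {ffun 'I_q -> bool}) (k : nat) : bool :=
  if insub k is Some k' then x k' else false.

(* the vertex of the cube (a,e) with coordinates x in {0,1}^q, where the
   k-th nondegenerate coordinate (increasing order) is a_{j_k} + x_k *)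
Definition vert n (a : pt n) (e : {set 'I_n}) q (x : {ffun 'I_q -> bool}) : pt n :=
  [ffun i => (a i + (if i \in e then (xb x (index i (elist e)) : nat)%:Z else 0))%R].

Definition verts n (c : cube n) : seq (pt n) :=
  [seq vert c.1 c.2 x | x <- enum {ffun 'I_#|c.2| -> bool}].

Definition cubes n (X : {fset pt n}) (q : nat) : seq (cube n) :=
  filter (fun c : cube n => (#|c.2| == q) && all (fun v => v \in X) (verts c))
    [seq ((a, e) : cube n) | a <- enum_fset X, e <- enum {set 'I_n}].

Definition ncubes n (X : {fset pt n}) q := size (cubes X q).

Definition cube_at n (X : {fset pt n}) q (i : 'I_(ncubes X q)) : cube n :=
  nth ((0%R : pt n), set0) (cubes X q) i.

Definition unitv n (j : 'I_n) : pt n := [ffun i => if i == j then 1%R else 0%R].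
Definition faceA n (c : cube n) (j : 'I_n) : cube n := (c.1, c.2 :\ j).
Definition faceB n (c : cube n) (j : 'I_n) : cube n := ((c.1 + unitv j)%R, c.2 :\ j).

(* coefficient of tau in  d sigma = sum_{i=1}^q (-1)^i (A_{j_i} sigma - B_{j_i} sigma) *)
Definition bd_coef n (s t : cube n) : int :=
  (\sum_(j in s.2)
     (-1) ^+ (index j (elist s.2)).+1 *
     ((t == faceA s j)%:R - (t == faceB s j)%:R))%R.

(* boundary matrix from q+1-cubes to q-cubes (row-vector convention:
   a chain c is a row vector, its boundary is c *m bdmx) *)
Definition bdmx n (X : {fset pt n}) q : 'M[rat]_(ncubes X q.+1, ncubes X q) :=
  \matrix_(i, j) (bd_coef (cube_at i) (cube_at j))%:~R.

(* coefficient of tau in \bar f_q(sigma):  sgn(pi) (-1)^r  if f restricted to sigma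
   has the form (x_1..x_q) |-> (y_1..y_q), y_i = x_{pi i} or 1 - x_{pi i}
   (r flips), mapping the vertex x of sigma to the vertex y of tau; 0 otherwise *)
Definition fcoef n (f : pt n -> pt n) q (s t : cube n) : int :=
  if (#|s.2| == q) && (#|t.2| == q) then
    (\sum_(p : {perm 'I_q}) \sum_(r : {set 'I_q})
       if [forall x : {ffun 'I_q -> bool},
             f (vert s.1 s.2 x) == vert t.1 t.2 [ffun i => x (p i) (+) (i \in r)]]
       then (-1) ^+ (odd_perm p) * (-1) ^+ #|r| else 0)%R
  else 0%R.

Definition chainmx n (X : {fset pt n}) (f : pt n -> pt n) q : 'M[rat]_(ncubes X q) :=
  \matrix_(i, j) (fcoef f q (cube_at i) (cube_at j))%:~R.

Definition cyclesmx n (X : {fset pt n}) q : 'M[rat]_(ncubes X q) :=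
  match q return 'M[rat]_(ncubes X q) with
  | 0 => 1%:M
  | q'.+1 => kermx (bdmx X q')
  end.

(* Trace of the map induced on the quotient Z/B by a matrix F preserving Z and B
   (row spaces).  Z/B is represented by the complement H := Z :\: B of B in Z,
   with the induced map w |-> projection of (w F) onto H along B, written in the
   basis row_base H. *)
Definition quot_trace m k (F Z : 'M[rat]_m) (B : 'M[rat]_(k, m)) : rat :=
  let H := (Z :\: B)%MS in
  let W := row_base H in
  \tr (W *m F *m proj_mx H (<<B>>%MS) *m pinvmx W).

Definition hom_trace n (X : {fset pt n}) (f : pt n -> pt n) q : rat :=
  quot_trace (chainmx X f q) (cyclesmx X q) (bdmx X q).

(* cubical Lefschetz number; \bar H_q(X) = 0 for q > n *)
Definition lefschetz n (X : {fset pt n}) (f : pt n -> pt n) : rat :=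
  (\sum_(q < n.+1) (-1) ^+ q * hom_trace X f q)%R.

(* Main.v *)
Require Import Defs.
From HB Require Import structures.
From mathcomp Require Import all_boot all_order all_algebra all_fingroup.
From mathcomp Require Import finmap zify.
Set Implicit Arguments. Unset Strict Implicit. Unset Printing Implicit Defensive.
Import Order.TTheory GRing.Theory Num.Theory.
Local Open Scope fset_scope.
Local Open Scope ring_scope.

(** By the Hopf trace formula, the Lefschetz number is the alternating sum of
the traces of the chain map, so if it is nonzero some cube is mapped onto
itself.  What has to be shown is that [f] induces a chain map.  Let [g] be the
restriction of [f] to a (q+1)-cube.  If [g] is an isomorphism onto a cube,
this is a computation of signs of permutations.  Otherwise, for every q-cube
[t], the signed faces that [g] maps isomorphically onto [t] must cancel.  Fix
one such face, identify it with [t], and label a vertex [x] of the opposite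
face by [k] if [g] maps it to the neighbour of [x] in [t] in direction [k].
Continuity says that two labels that differ along an edge of direction [m] are
not both different from [m].  For [q <= 3] an exhaustive search shows that
either there are no labels at all, or all [x] in some facet [x k = d] have label
[k], or the labels are those of a quarter turn.  In each case the faces
mapped onto [t] can be listed, and they cancel. *)

(** * Traces on kernels, images and quotients *)

(** [pinvmx B *m B] is a projection onto the row space of [B], so this is the trace of [F] on that
    space when [F] preserves it. *)
Definition im_trace m k (F : 'M[rat]_m) (B : 'M[rat]_(k, m)) : rat :=
  \tr (F *m (pinvmx B *m B)).

Lemma quot_traceE m k (F Z : 'M[rat]_m) (B : 'M[rat]_(k, m)) :
  quot_trace F Z B = \tr (F *m proj_mx (Z :\: B)%MS <<B>>%MS).
Proof.
rewrite /quot_trace; set H := (Z :\: B)%MS; set P := proj_mx _ _.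
rewrite -[_ *m _ *m pinvmx _]mulmxA mxtrace_mulC mulmxA mulmxKpV 1?mxtrace_mulC //.
by rewrite eq_row_base -[P]mul1mx proj_mx_sub.
Qed.

(** [E] is a projection onto [Z], so the left-hand side is the trace of [F] on [Z]; it is additive
    along [B] inside [Z]. *)
Lemma trace_split m k (F Z E : 'M[rat]_m) (B : 'M[rat]_(k, m)) :
  (B <= Z)%MS -> (Z *m F <= Z)%MS -> (B *m F <= B)%MS ->
  (E <= Z)%MS -> Z *m E = Z ->
  \tr (F *m E) = quot_trace F Z B + im_trace F B.
Proof.
move=> sBZ sZF sBF sEZ ZE; rewrite quot_traceE /im_trace.
set H := (Z :\: B)%MS; set P := proj_mx _ _; set Q := pinvmx B *m B.
have HB0 : (H :&: <<B>> = 0)%MS.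
  by apply/eqP; rewrite -submx0 -(capmx_diff Z B) capmxS ?genmxE.
have sHZ : (H <= Z)%MS by exact: diffmxSl.
have sPH p (A : 'M_(p, m)) : (A *m P <= H)%MS by exact: proj_mx_sub.
have PH : (P <= H)%MS by rewrite -[P]mul1mx.
have BP p (A : 'M_(p, m)) : (A <= B)%MS -> A *m P = 0.
  by move=> sA; apply: proj_mx_0; rewrite ?genmxE.
have BQ p (A : 'M_(p, m)) : (A <= B)%MS -> A *m Q = A.
  by move=> sA; rewrite mulmxA mulmxKpV.
have ZEg p (A : 'M_(p, m)) : (A <= Z)%MS -> A *m E = A.
  by case/submxP=> D ->; rewrite -mulmxA ZE.
have ZP p (A : 'M_(p, m)) : (A <= Z)%MS -> (A - A *m P <= B)%MS.
  move=> sA; have sAHB : (A <= H + <<B>>)%MS.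
    apply: (submx_trans sA); rewrite -(addsmx_diff_cap_eq Z B) addsmxS //.
    by rewrite genmxE capmxSr.
  rewrite -{1}(add_proj_mx HB0 sAHB) addrC addKr.
  by rewrite (submx_trans (proj_mx_sub _ _ _)) ?genmxE.
(* The component in the complement [H], plus the component in [B], which [Q] fixes. *)
have -> : E = E *m P + (E - E *m P) *m Q.
  by rewrite BQ ?ZP // addrC subrK.
have FZ p (A : 'M_(p, m)) : (A <= Z)%MS -> (A *m F <= Z)%MS.
  by move=> sA; rewrite (submx_trans _ sZF) ?submxMr.
have FB p (A : 'M_(p, m)) : (A <= B)%MS -> (A *m F <= B)%MS.
  by move=> sA; rewrite (submx_trans _ sBF) ?submxMr.
have QB : (Q <= B)%MS by exact: submxMl.
rewrite mulmxDr mxtraceD; congr (_ + _).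
  rewrite mulmxA mxtrace_mulC mulmxA ZEg 1?mxtrace_mulC //.
  by rewrite FZ ?(submx_trans PH).
(* By cyclicity the second trace is that of [Q *m F *m (E - E *m P)]. The rows of [Q *m F] lie in
   [B], where [E] is the identity and [P] vanishes. *)
have QFE : Q *m F *m E = Q *m F by rewrite ZEg // FZ // (submx_trans QB).
clearbody P Q; rewrite mulmxA mxtrace_mulC mulmxA mulmxBr !mulmxA QFE.
by rewrite BP ?FB // subr0 mxtrace_mulC.
Qed.

(** [1%:M - d *m pinvmx d] projects onto the kernel of [d]. The complementary trace moves to the
    image of [d] by [F *m d = d *m G] and cyclicity. *)
Lemma trace_kernel_split m k l (F : 'M[rat]_m) (G : 'M[rat]_l) (d : 'M[rat]_(m, l))
    (B : 'M[rat]_(k, m)) :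
  B *m d = 0 -> F *m d = d *m G -> (B *m F <= B)%MS ->
  \tr F = quot_trace F (kermx d) B + im_trace F B + im_trace G d.
Proof.
move=> Bd0 Fd BF; set s := pinvmx d.
rewrite -(@trace_split m k F (kermx d) (1%:M - d *m s) B) //.
- have -> : im_trace G d = \tr (F *m (d *m s)).
    by rewrite /im_trace [F *m _]mulmxA Fd -[d *m G *m s]mulmxA [RHS]mxtrace_mulC -[G *m s *m d]mulmxA.
  by rewrite -mxtraceD -mulmxDr subrK mulmx1.
- exact/sub_kermxP.
- by apply/sub_kermxP; rewrite -mulmxA Fd mulmxA mulmx_ker mul0mx.
- by apply/sub_kermxP; rewrite mulmxBl mul1mx mulmxKpV ?subrr.
- by rewrite mulmxBr mulmx1 mulmxA mulmx_ker mul0mx subr0.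
Qed.

(** * Labelled cubes of dimension at most three *)

Definition flip q (k : 'I_q) (x : {ffun 'I_q -> bool}) : {ffun 'I_q -> bool} :=
  [ffun i => x i (+) (i == k)].

Lemma flipK q (k : 'I_q) : involutive (flip k).
Proof. by move=> x; apply/ffunP=> i; rewrite !ffunE addbK. Qed.

Lemma flipC q (k m : 'I_q) x : flip k (flip m x) = flip m (flip k x).
Proof. by apply/ffunP=> i; rewrite !ffunE addbAC. Qed.

Section LabelSearch.
Local Open Scope nat_scope.

Fixpoint bitseqs q : seq bitseq :=
  if q is q'.+1 then [seq b :: v | b <- [:: true; false], v <- bitseqs q'] else [:: [::]].

Definition flipb (m : nat) (v : bitseq) : bitseq :=
  [seq nth false v i (+) (i == m) | i <- iota 0 (size v)].

(* Labels are coded as [0] for [None] and [k.+1] for [Some k]. *)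
Definition edge_ok q (v : bitseq) (l : nat) (w : bitseq) (l' : nat) : bool :=
  all (fun m => (w == flipb m v) ==> [|| l == l', l == m.+1 | l' == m.+1]) (iota 0 q).

Fixpoint labelings q (vs : seq bitseq) : seq (seq (bitseq * nat)) :=
  if vs is v :: vs' then
    flatten [seq [seq (v, l) :: t | l <- iota 0 q.+1 & all (fun p => edge_ok q v l p.1 p.2) t]
            | t <- labelings q vs']
  else [:: [::]].

(** The last shape is a quarter turn of the plane of directions [k] and [m]: moving every vertex
    along its label sends (0,0), (1,0), (1,1), (0,1) cyclically each to the next. *)
Definition has_shape q (t : seq (bitseq * nat)) : bool :=
  [|| all (fun p => p.2 == 0) t,
      has (fun k => has (fun d =>
        all (fun p => (nth false p.1 k == d) ==> (p.2 == k.+1)) t) [:: true; false]) (iota 0 q)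
    | has (fun k => has (fun m => (k != m) &&
        all (fun p => p.2 == (if nth false p.1 k == nth false p.1 m then k.+1 else m.+1)) t)
          (iota 0 q)) (iota 0 q)].

(** The bound on the dimension of the ambient space enters the proof only through this search. *)
Lemma labelings_shape q : q <= 3 -> all (has_shape q) (labelings q (bitseqs q)).
Proof. by move: q; do 4!case=> //; move=> _; vm_compute. Qed.

Lemma mem_bitseqs q (v : bitseq) : size v = q -> v \in bitseqs q.
Proof.
elim: q v => [|q IH] [|b v] //= [sv].
by rewrite !mem_cat; case: b; rewrite map_f ?orbT ?IH.
Qed.

Lemma mem_labelings q (L : bitseq -> nat) vs :
  (forall v, L v <= q) -> {in vs &, forall v w, edge_ok q v (L v) w (L w)} ->
  [seq (v, L v) | v <- vs] \in labelings q vs.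
Proof.
move=> Lq; elim: vs => [|v vs IH] //= ok.
apply/flattenP; exists [seq (v, l) :: [seq (v, L v) | v <- vs] | l <- iota 0 q.+1 &
    all (fun p => edge_ok q v l p.1 p.2) [seq (v, L v) | v <- vs]].
  apply/mapP; exists [seq (v, L v) | v <- vs] => //.
  by apply: IH => u w uvs wvs; apply: ok; rewrite inE ?uvs ?wvs orbT.
apply: (map_f (fun l => (v, l) :: _)); rewrite mem_filter mem_iota ltnS Lq !andbT.
rewrite all_map; apply/allP=> w wvs /=.
by apply: ok; rewrite inE ?eqxx ?wvs ?orbT.
Qed.

End LabelSearch.

(** The search runs on bit sequences and numbers, which evaluate well; here its result is carried
    over to finite functions and ordinals. *)
Lemma label_shapes q (lab : {ffun 'I_q -> bool} -> option 'I_q) :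
  (q <= 3)%N ->
  (forall x m, lab x <> lab (flip m x) -> lab x = Some m \/ lab (flip m x) = Some m) ->
  [\/ forall x, lab x = None,
      exists (k : 'I_q) (d : bool), forall x : {ffun 'I_q -> bool}, x k = d -> lab x = Some k
    | exists k m : 'I_q, k != m /\ forall x, lab x = Some (if x k == x m then k else m)].
Proof.
move=> q3 edge.
pose code (o : option 'I_q) := if o is Some k then k.+1 else 0%N.
have code_inj : injective code.
  by move=> [k|] [m|] //= [] /val_inj ->.
pose F (v : bitseq) : {ffun 'I_q -> bool} := [ffun i : 'I_q => nth false v i].
pose b (x : {ffun 'I_q -> bool}) : bitseq := [seq x i | i <- enum 'I_q].
have nthb x (k : 'I_q) : nth false (b x) k = x k.
  by rewrite (nth_map k) ?size_enum_ord // nth_ord_enum.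
have bK x : F (b x) = x by apply/ffunP=> i; rewrite ffunE nthb.
have b_in x : b x \in bitseqs q by rewrite mem_bitseqs // size_map size_enum_ord.
pose L v := code (lab (F v)).
have Lq v : (L v <= q)%N by rewrite /L; case: (lab _) => //= k; apply: ltn_ord.
have size_bits v : v \in bitseqs q -> size v = q.
  elim: (q) v => [|q' IH] v /=; first by rewrite inE => /eqP ->.
  by rewrite !mem_cat orbF => /orP[] /mapP[w /IH <- ->].
have ok : {in bitseqs q &, forall v w, edge_ok q v (L v) w (L w)}.
  move=> v w /size_bits sv _; apply/allP=> m; rewrite mem_iota add0n /= => mq.
  apply/implyP=> /eqP ->.
  have -> : L (flipb m v) = code (lab (flip (Ordinal mq) (F v))).
    congr (code (lab _)); apply/ffunP=> i; rewrite !ffunE (nth_map 0%N) ?size_iota ?sv //.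
    by rewrite nth_iota ?sv.
  rewrite /L; case: eqP => //= ne.
  have /edge[->|->] : lab (F v) <> lab (flip (Ordinal mq) (F v)) by move=> e; apply: ne; rewrite e.
    by rewrite eqxx.
  by rewrite eqxx orbT.
have lkp (P : bitseq * nat -> bool) x : all P [seq (v, L v) | v <- bitseqs q] -> P (b x, code (lab x)).
  by move/allP/(_ (b x, code (lab x))); apply; apply/mapP; exists (b x); rewrite // /L bK.
have /allP/(_ _ (mem_labelings Lq ok)) := labelings_shape q3.
case/or3P.
- by move=> a; constructor 1 => x; apply: code_inj; apply/eqP; exact: (lkp _ x a).
- case/hasP=> k; rewrite mem_iota add0n leq0n andTb => kq.
  case/hasP=> d _ a; constructor 2; exists (Ordinal kq), d => x xk.
  apply: code_inj; apply/eqP; have := lkp _ x a; rewrite /=.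
  by rewrite (nthb x (Ordinal kq)) xk eqxx.
- case/hasP=> k; rewrite mem_iota add0n leq0n andTb => kq.
  case/hasP=> m; rewrite mem_iota add0n leq0n andTb => mq /andP[km a].
  constructor 3; exists (Ordinal kq), (Ordinal mq); split=> // x.
  apply: code_inj; apply/eqP; have := lkp _ x a; rewrite /=.
  by rewrite (nthb x (Ordinal kq)) (nthb x (Ordinal mq)); case: ifP.
Qed.

(** * Signed permutations and vertices of cubes *)

(** The action of the hyperoctahedral group on the vertices of the cube, in the form that [fcoef]
    uses. *)
Definition sact q (p : 'S_q) (r : {set 'I_q}) (x : {ffun 'I_q -> bool}) :
  {ffun 'I_q -> bool} := [ffun i => x (p i) (+) (i \in r)].

(** The determinant of the signed permutation matrix. *)
Definition ssgn q (p : 'S_q) (r : {set 'I_q}) : int := (-1) ^+ (odd_perm p) * (-1) ^+ #|r|.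

Definition ins q (l : 'I_q.+1) (c : bool) (x : {ffun 'I_q -> bool}) :
  {ffun 'I_q.+1 -> bool} := [ffun i => if unlift l i is Some m then x m else c].

Lemma ins_id q (l : 'I_q.+1) c x : ins l c x l = c.
Proof. by rewrite ffunE unlift_none. Qed.

Lemma ins_lift q (l : 'I_q.+1) c x m : ins l c x (lift l m) = x m.
Proof. by rewrite ffunE liftK. Qed.

Lemma insP q (l : 'I_q.+1) (z : {ffun 'I_q.+1 -> bool}) :
  z = ins l (z l) [ffun m => z (lift l m)].
Proof. by apply/ffunP=> i; case: (unliftP l i) => [m|] ->; rewrite ?ins_id // ins_lift ffunE. Qed.

Lemma ins_flip q (l : 'I_q.+1) c m x : ins l c (flip m x) = flip (lift l m) (ins l c x).
Proof.
apply/ffunP=> i; case: (unliftP l i) => [m'|] ->; rewrite ?(ins_id, ins_lift) !ffunE.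
  by rewrite liftK (inj_eq lift_inj).
by rewrite unlift_none eq_liftF addbF.
Qed.

Lemma ins_negb q (l : 'I_q.+1) c x : ins l (~~ c) x = flip l (ins l c x).
Proof.
apply/ffunP=> i; case: (unliftP l i) => [m'|] ->; rewrite ?(ins_id, ins_lift) !ffunE.
  by rewrite liftK lift_eqF addbF.
by rewrite unlift_none eqxx addbT.
Qed.

Lemma sact_surj q (p : 'S_q) r y : exists x, sact p r x = y.
Proof.
exists [ffun i => y (p^-1%g i) (+) (p^-1%g i \in r)].
by apply/ffunP=> i; rewrite !ffunE permK addbK.
Qed.

Lemma sact_inj q (p : 'S_q) r : injective (sact p r).
Proof.
move=> x y e; apply/ffunP=> i; have := congr1 (fun z : {ffun _ -> _} => z (p^-1%g i)) e.
by rewrite !ffunE permKV => /addIb.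
Qed.

(** The zero vertex determines the reflections; then the vertices with a single coordinate 1
    determine the permutation. *)
Lemma sact_eq q (p p' : 'S_q) r r' : sact p r =1 sact p' r' -> p = p' /\ r = r'.
Proof.
move=> e; have er : r = r'.
  by apply/setP=> i; have /ffunP/(_ i) := e [ffun => false]; rewrite !ffunE.
split=> //; apply/permP=> i; have /ffunP/(_ i) := e [ffun j => j == p i].
by rewrite er !ffunE => /addIb; rewrite eqxx => /esym/eqP.
Qed.

Lemma signr_card q (r : {set 'I_q}) : (-1) ^+ #|r| = \prod_i (-1) ^+ (i \in r) :> int.
Proof.
rewrite -prodr_const [LHS]big_mkcond; apply: eq_bigr => i _.
by case: (i \in r).
Qed.

Definition scomp q (p : 'S_q) (r r' : {set 'I_q}) := [set i | (p i \in r') (+) (i \in r)].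

Lemma sactM q (p p' : 'S_q) r r' x :
  sact p r (sact p' r' x) = sact (p * p')%g (scomp p r r') x.
Proof. by apply/ffunP=> i; rewrite !ffunE inE permM addbA. Qed.

Lemma ssgnM q (p p' : 'S_q) r r' :
  ssgn (p * p')%g (scomp p r r') = ssgn p r * ssgn p' r'.
Proof.
rewrite /ssgn odd_permM signr_addb !signr_card.
have -> : \prod_i (-1) ^+ (i \in scomp p r r') =
    (\prod_i (-1) ^+ (i \in r)) * (\prod_i (-1) ^+ (i \in r')) :> int.
  rewrite [X in _ * X](reindex_inj (@perm_inj _ p)) -big_split /=.
  by apply: eq_bigr => i _; rewrite inE signr_addb mulrC.
exact: mulrACA.
Qed.

Lemma ssgn_sq q (p : 'S_q) r : ssgn p r * ssgn p r = 1.
Proof. by rewrite /ssgn mulrACA -!expr2 !sqrr_sign mulr1. Qed.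

Lemma sact_ins q (p : 'S_q) (l i : 'I_q.+1) R c x :
  sact (lift_perm l i p) R (ins i c x) =
  ins l (c (+) (l \in R)) (sact p [set m | lift l m \in R] x).
Proof.
apply/ffunP=> j; case: (unliftP l j) => [m|] ->; rewrite ?(ins_id, ins_lift) !ffunE.
  by rewrite lift_perm_lift liftK inE.
by rewrite lift_perm_id unlift_none.
Qed.

(** Laplace expansion of a signed permutation matrix along row [l], whose only nonzero entry is in
    column [i]. *)
Lemma ssgn_lift q (p : 'S_q) (l i : 'I_q.+1) R :
  ssgn (lift_perm l i p) R =
  (-1) ^+ (l + i) * (-1) ^+ (l \in R) * ssgn p [set m | lift l m \in R].
Proof.
rewrite /ssgn odd_lift_perm !signr_addb !signr_odd signr_card (bigD1_ord l) //=.
have -> : \prod_(j < q) (-1) ^+ (lift l j \in R) =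
    (-1) ^+ #|[set m | lift l m \in R]| :> int.
  by rewrite signr_card; apply: eq_bigr => m _; rewrite inE.
by rewrite exprD; exact: mulrACA.
Qed.

Lemma lift_permE q (s : 'S_q.+1) (l : 'I_q.+1) : exists p, s = lift_perm l (s l) p.
Proof.
pose u m := odflt m (unlift (s l) (s (lift l m))).
have uK m : lift (s l) (u m) = s (lift l m).
  rewrite /u; have := neq_lift l m.
  by rewrite -(inj_eq (@perm_inj _ s)) => /unlift_some[] ? ? ->.
have u_inj : injective u.
  move=> m m' e; apply: (@lift_inj _ l); apply: (@perm_inj _ s).
  by rewrite -!uK e.
exists (perm u_inj); apply/permP=> i.
by case: (unliftP l i) => [m|] ->; rewrite ?lift_perm_id // lift_perm_lift permE uK.
Qed.

Section Vert.
Variable n : nat.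
Implicit Types (a : pt n) (e : {set 'I_n}) (s t : cube n).

Lemma elist_uniq e : uniq (elist e).
Proof. by rewrite filter_uniq ?enum_uniq. Qed.

Lemma mem_elist e i : (i \in elist e) = (i \in e).
Proof. by rewrite mem_filter mem_enum andbT. Qed.

Lemma elist_enum e : elist e = enum e.
Proof. by rewrite /elist /enum_mem -filter_predI; apply: eq_filter => i; rewrite /= andbT. Qed.

Lemma size_elist e : size (elist e) = #|e|.
Proof. by rewrite elist_enum cardE. Qed.

Lemma index_elist e i : i \in e -> (index i (elist e) < #|e|)%N.
Proof. by rewrite -mem_elist -size_elist index_mem. Qed.

(** Passes from nondegenerate directions to their ranks. The index of an element of [e] is below
    [#|e|], so [inord] never falls back on its default. *)
Lemma sum_elist (V : zmodType) q e (H : 'I_q.+1 -> V) :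
  #|e| = q.+1 -> \sum_(j in e) H (inord (index j (elist e))) = \sum_l H l.
Proof.
move=> ce; rewrite -big_enum -elist_enum /=.
have [j0 _] : exists j, j \in e by apply/card_gt0P; rewrite ce.
rewrite (big_nth j0) big_mkord size_elist ce; apply: eq_bigr => l _.
by rewrite index_uniq ?elist_uniq ?size_elist ?ce // inord_val.
Qed.

Lemma vertE a e q (x : {ffun 'I_q -> bool}) i (k : 'I_q) :
  #|e| = q -> i \in e -> index i (elist e) = k -> vert a e x i = a i + (x k : nat)%:Z.
Proof. by move=> ce ie ik; rewrite ffunE ie /xb ik valK. Qed.

Lemma vert_out a e q (x : {ffun 'I_q -> bool}) i : i \notin e -> vert a e x i = a i.
Proof. by move=> ie; rewrite ffunE (negPf ie) addr0. Qed.

Lemma elist_nth e q (k : 'I_q) :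
  #|e| = q -> exists2 i, i \in e & index i (elist e) = k.
Proof.
move=> ce; have [i0 _] : exists i, i \in e.
  by apply/card_gt0P; rewrite ce; case: (q) k => // -[].
have ks : (k < size (elist e))%N by rewrite size_elist ce.
exists (nth i0 (elist e) k); first by rewrite -mem_elist mem_nth.
by rewrite index_uniq ?elist_uniq.
Qed.

Lemma vert_inj a e q : #|e| = q -> injective (vert a e (q := q)).
Proof.
move=> ce x y exy; apply/ffunP=> k; have [i ie ik] := elist_nth k ce.
have := congr1 (fun z : pt n => z i) exy; rewrite !(vertE _ _ ce ie ik).
by move/addrI; case: (x k); case: (y k).
Qed.

Lemma vert0 a e q : vert a e ([ffun => false] : {ffun 'I_q -> bool}) = a.
Proof.
apply/ffunP=> i; rewrite ffunE; case: ifP => _; rewrite ?addr0 //.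
by rewrite /xb; case: insub => [k|]; rewrite ?ffunE addr0.
Qed.

Lemma vert1 a e q i :
  #|e| = q -> vert a e ([ffun => true] : {ffun 'I_q -> bool}) i = a i + (i \in e : nat)%:Z.
Proof.
move=> ce; case: (boolP (i \in e)) => ie; last by rewrite vert_out ?addr0.
have iq : (index i (elist e) < q)%N by rewrite -ce index_elist.
by rewrite (@vertE a e q _ i (Ordinal iq)) // ffunE.
Qed.

Lemma vert_ge a e q (x : {ffun 'I_q -> bool}) i : a i <= vert a e x i <= a i + (i \in e : nat)%:Z.
Proof.
rewrite ffunE; case: (i \in e) => /=; last by rewrite addr0 lexx.
by case: (xb x _); rewrite ?addr0 lexx ?lerDl.
Qed.


(** The least vertex is the base point and the greatest shows the directions, so a cube is
    determined by its vertex set. *)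
Lemma vert_cube_eq q s t (h h' : {ffun 'I_q -> bool} -> {ffun 'I_q -> bool}) :
  #|s.2| = q -> #|t.2| = q ->
  (forall y, exists x, h x = y) -> (forall y, exists x, h' x = y) ->
  (forall x, vert s.1 s.2 (h x) = vert t.1 t.2 (h' x)) -> s = t.
Proof.
case: s t => [a e] [a' e'] /= ce ce' hs hs' eh.
have [x0 x0E] := hs [ffun => false]; have [x1 x1E] := hs [ffun => true].
have [y0 y0E] := hs' [ffun => false]; have [y1 y1E] := hs' [ffun => true].
have ea i : a i = a' i.
  have := congr1 (fun z : pt n => z i) (eh x0); rewrite x0E vert0.
  have := congr1 (fun z : pt n => z i) (eh y0); rewrite y0E vert0.
  have := vert_ge a e (h y0) i; have := vert_ge a' e' (h' x0) i; lia.
congr (_, _); first exact/ffunP.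
apply/setP=> i; have := ea i.
have := congr1 (fun z : pt n => z i) (eh x1); rewrite x1E vert1 //.
have := congr1 (fun z : pt n => z i) (eh y1); rewrite y1E vert1 //.
have := vert_ge a e (h y1) i; have := vert_ge a' e' (h' x1) i.
case: (i \in e); case: (i \in e') => //=; lia.
Qed.

Definition face s (j : 'I_n) (c : bool) := if c then faceB s j else faceA s j.

Lemma elistD1 e j : elist (e :\ j) = rem j (elist e).
Proof.
rewrite rem_filter ?elist_uniq // -filter_predI; apply: eq_filter => i.
by rewrite /= in_setD1 andbC.
Qed.

Lemma index_rem (T : eqType) (s : seq T) i j :
  i != j -> j \in s -> index i (rem j s) = unbump (index j s) (index i s).
Proof.
move=> ij; elim: s => //= x s IH; rewrite inE.
have [-> _|xj] := eqVneq x j; first by rewrite eq_sym (negPf ij) /unbump subn1.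
move=> /= js; have [//|xi] := eqVneq x i.
by rewrite IH // /unbump ltnS; case: ltnP => // ?; lia.
Qed.

Lemma card_face s j c q : j \in s.2 -> #|s.2| = q.+1 -> #|(face s j c).2| = q.
Proof. by move=> js; rewrite (cardsD1 j) js => -[<-]; case: c. Qed.

Lemma vert_face q s j c (x : {ffun 'I_q -> bool}) :
  j \in s.2 -> #|s.2| = q.+1 ->
  vert (face s j c).1 (face s j c).2 x = vert s.1 s.2 (ins (inord (index j (elist s.2))) c x).
Proof.
case: s => a e /= je ce; set l := inord _.
have lj : index j (elist e) = l by rewrite inordK // -ce index_elist.
have f2 : (face (a, e) j c).2 = e :\ j by case: c.
have f1 i : (face (a, e) j c).1 i = a i + ((i == j) && c : nat)%:Z.
  by case: c {f2}; rewrite /= ?andbT ?andbF ?addr0 // !ffunE; case: eqP.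
have ceD : #|e :\ j| = q by rewrite -f2; apply: card_face.
apply/ffunP=> i; rewrite f2; have [->|ij] := eqVneq i j.
  by rewrite (vertE _ _ ce je lj) ins_id vert_out ?inE ?eqxx // f1 eqxx.
case: (boolP (i \in e)) => ie; last first.
  by rewrite !vert_out ?inE ?(negPf ie) ?andbF // f1 (negPf ij) addr0.
have iD : i \in e :\ j by rewrite !inE ij.
have iq : (index i (elist (e :\ j)) < q)%N by rewrite -ceD index_elist.
have ik : index i (elist e) = lift l (Ordinal iq).
  rewrite /= elistD1 index_rem ?mem_elist // lj unbumpK //.
  rewrite inE; apply: contra ij => /eqP il; apply/eqP.
  by rewrite -[LHS](nth_index j (s := elist e)) ?mem_elist // il -lj nth_index ?mem_elist.
rewrite (vertE _ _ ce ie ik) ins_lift (@vertE _ _ _ _ i (Ordinal iq)) //.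
by rewrite f1 (negPf ij) addr0.
Qed.

(** The coefficient of [fcoef] for a map on the standard cube, so that it can be precomposed with
    the face inclusions [ins]. *)
Definition deg q (h : {ffun 'I_q -> bool} -> pt n) t : int :=
  \sum_(p : 'S_q) \sum_(r : {set 'I_q})
     if [forall x, h x == vert t.1 t.2 (sact p r x)] then ssgn p r else 0.

Lemma fcoefE f q s t :
  fcoef f q s t = if (#|s.2| == q) && (#|t.2| == q)
                  then deg (fun x : {ffun 'I_q -> bool} => f (vert s.1 s.2 x)) t else 0.
Proof. by []. Qed.

Lemma deg_neq0 q (h : {ffun 'I_q -> bool} -> pt n) t :
  deg h t != 0 -> exists p r, forall x, h x = vert t.1 t.2 (sact p r x).
Proof.
move=> d0; have [/existsP[p /existsP[r /forallP pr]]|no] :=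
  boolP [exists p : 'S_q, exists r : {set 'I_q}, forall x, h x == vert t.1 t.2 (sact p r x)].
  by exists p, r => x; apply/eqP.
case/eqP: d0; apply: big1 => p _; apply: big1 => r _; case: ifP => // pr.
by case/existsP: no; exists p; apply/existsP; exists r.
Qed.

Lemma deg_iso q (h : {ffun 'I_q -> bool} -> pt n) t p r :
  #|t.2| = q -> (forall x, h x = vert t.1 t.2 (sact p r x)) -> deg h t = ssgn p r.
Proof.
move=> ct hE; rewrite /deg (bigD1 p) //= (bigD1 r) //=.
have H p' r' : [forall x, h x == vert t.1 t.2 (sact p' r' x)] -> p' = p /\ r' = r.
  move=> /forallP h'; apply: sact_eq => x; apply: (vert_inj (a := t.1) ct).
  by rewrite -hE; apply/esym/eqP.
rewrite ifT; last by apply/forallP=> x; rewrite hE.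
rewrite !big1 ?addr0 // => [p' p'p|r' r'r].
  by apply: big1 => r' _; case: ifP => // /H[e]; rewrite e eqxx in p'p.
by case: ifP => // /H[_ e]; rewrite e eqxx in r'r.
Qed.

End Vert.

(** * The boundary operator *)

Section Cubes.
Variables (n : nat) (X : {fset pt n}).
Implicit Types (s t c : cube n).

Lemma vertsP c :
  reflect (forall x : {ffun 'I_#|c.2| -> bool}, vert c.1 c.2 x \in X)
          (all (fun v => v \in X) (verts c)).
Proof.
rewrite all_map; apply: (iffP allP) => [h x|h x _]; last exact: h.
by apply: h; rewrite mem_enum.
Qed.

Lemma cubesP q c :
  reflect (#|c.2| = q /\ forall x : {ffun 'I_q -> bool}, vert c.1 c.2 x \in X)
          (c \in cubes X q).
Proof.
rewrite mem_filter; apply: (iffP andP) => [[/andP[/eqP <- /vertsP h] _] //|[<- h]].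
rewrite eqxx; split; first exact/vertsP.
have cX : c.1 \in X by rewrite -(vert0 c.1 c.2 #|c.2|).
case: c cX {h} => a e /= aX; apply/allpairsP; exists (a, e); split=> //=.
by rewrite mem_enum.
Qed.

Lemma cubes_uniq q : uniq (cubes X q).
Proof.
rewrite filter_uniq // allpairs_uniq ?enum_uniq ?fset_uniq //.
by move=> [a e] [a' e'].
Qed.

Lemma cube_at_in q (i : 'I_(ncubes X q)) : cube_at i \in cubes X q.
Proof. exact: mem_nth. Qed.

Lemma sum_cubes (V : zmodType) q (G : cube n -> V) :
  \sum_(i < ncubes X q) G (cube_at i) = \sum_(c <- cubes X q) G c.
Proof. by rewrite (big_nth ((0 : pt n), set0)) big_mkord. Qed.

Lemma sum_cubes_pick q c (G : cube n -> int) :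
  c \in cubes X q -> \sum_(r <- cubes X q) (r == c)%:R * G r = G c.
Proof.
move=> cX; rewrite (bigD1_seq c) ?cubes_uniq //= eqxx mul1r big1 ?addr0 // => r /negPf ->.
by rewrite mul0r.
Qed.

Lemma face_cubes q s j b : s \in cubes X q.+1 -> j \in s.2 -> face s j b \in cubes X q.
Proof.
move=> /cubesP[cs sX] js; apply/cubesP; split; first exact: card_face.
by move=> x; rewrite vert_face.
Qed.

Lemma sum_bd_coef q s (G : cube n -> int) :
  s \in cubes X q.+1 ->
  \sum_(r <- cubes X q) bd_coef s r * G r =
  \sum_(j in s.2) (-1) ^+ (index j (elist s.2)).+1 * (G (face s j false) - G (face s j true)).
Proof.
move=> sX.
rewrite (eq_bigr (fun r => \sum_(j in s.2) (-1) ^+ (index j (elist s.2)).+1 *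
   ((r == face s j false)%:R * G r - (r == face s j true)%:R * G r))); last first.
  by move=> r _; rewrite big_distrl; apply: eq_bigr => j _; rewrite /= -mulrA mulrBl.
rewrite exchange_big; apply: eq_bigr => j js; rewrite -big_distrr /= sumrB.
rewrite !sum_cubes_pick //; first exact: (face_cubes true).
exact: (face_cubes false).
Qed.

Lemma face_face s i j (b c : bool) : face (face s i b) j c = face (face s j c) i b.
Proof. by case: b; case: c; rewrite /face /faceA /faceB /= setDDl setUC -setDDl // addrAC. Qed.

(** Iterated faces in two directions do not depend on the order, but the signs do: deleting one
    direction shifts the rank of the other only if the other is later. *)
Lemma sum_bd_coef2 q s t :
  s \in cubes X q.+2 -> \sum_(r <- cubes X q.+1) bd_coef s r * bd_coef r t = 0.
Proof.
move=> sX; rewrite sum_bd_coef //.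
pose w (i j : 'I_n) : int := (-1) ^+ (index i (elist s.2)).+1 *
  (-1) ^+ (unbump (index i (elist s.2)) (index j (elist s.2))).+1.
pose v i j : int :=
  ((t == face (face s i false) j false)%:R - (t == face (face s i false) j true)%:R) -
  ((t == face (face s i true) j false)%:R - (t == face (face s i true) j true)%:R).
rewrite (eq_bigr (fun i => \sum_(j in s.2 | j != i) w i j * v i j)); last first.
  move=> i si; rewrite /bd_coef /face /= -sumrB big_distrr /=.
  apply: eq_big => [j|j]; first by rewrite !inE andbC.
  rewrite !inE => /andP[ji js].
  by rewrite elistD1 index_rem ?mem_elist // -mulrBr mulrA.
have vC i j : v i j = v j i by rewrite /v !(face_face s i j); lia.
have wC i j : i \in s.2 -> j \in s.2 -> j != i -> w i j = - w j i.
  move=> si sj ji; rewrite /w /unbump.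
  have : index i (elist s.2) != index j (elist s.2).
    apply: contra ji => /eqP e; rewrite -[j](nth_index i (s := elist s.2)) ?mem_elist //.
    by rewrite -e nth_index ?mem_elist.
  case: ltngtP => // lt _; rewrite ?subn0 subn1 /=.
    by rewrite (ltn_predK lt) !exprS; lia.
  by rewrite (ltn_predK lt) !exprS; lia.
set S := \sum_(i in _) _.
(* Exchanging the two directions turns [S] into [- S]. *)
suff : S = - S by lia.
rewrite {1}/S (exchange_big_dep (fun j => j \in s.2)) /=; last by move=> i j _ /andP[].
rewrite -sumrN; apply: eq_bigr => j sj; rewrite -sumrN.
apply: eq_big => [i|i /andP[si /andP[_ ji]]]; first by rewrite sj eq_sym.
by rewrite wC // vC mulNr.
Qed.

Lemma eq_deg q (h h' : {ffun 'I_q -> bool} -> pt n) t : h =1 h' -> deg h t = deg h' t.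
Proof.
by move=> e; apply: eq_bigr => p _; apply: eq_bigr => r _; under eq_forallb do rewrite e.
Qed.

(** The coefficient of [t] in the image under [g] of the boundary of the standard cube; the exponent
    is [l.+1] because the boundary counts directions from 1. *)
Definition bdeg q (g : {ffun 'I_q.+1 -> bool} -> pt n) t : int :=
  \sum_(l < q.+1) (-1) ^+ l.+1 * (deg (g \o ins l false) t - deg (g \o ins l true) t).

Lemma sum_bd_fcoef f q s t :
  s \in cubes X q.+1 -> #|t.2| = q ->
  \sum_(r <- cubes X q) bd_coef s r * fcoef f q r t =
  bdeg (fun x : {ffun 'I_q.+1 -> bool} => f (vert s.1 s.2 x)) t.
Proof.
move=> sX ct; have /cubesP[cs _] := sX.
rewrite sum_bd_coef // /bdeg -(sum_elist _ cs); apply: eq_bigr => j js.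
rewrite inordK; last by rewrite -cs index_elist.
by congr (_ * (_ - _)); rewrite fcoefE (card_face _ js cs) ct eqxx /=;
   apply: eq_deg => x; rewrite /= -(vert_face _ _ js cs).
Qed.

Lemma bdeg_iso q (g : {ffun 'I_q.+1 -> bool} -> pt n) s t P R :
  #|s.2| = q.+1 -> #|t.2| = q ->
  (forall x, g x = vert s.1 s.2 (sact P R x)) -> bdeg g t = ssgn P R * bd_coef s t.
Proof.
move=> cs ct gE.
(* The facet [P l] of the source is the one that goes to the facet [l] of [s]. *)
rewrite /bdeg (reindex_inj (@perm_inj _ P)) -(sum_elist _ cs) /bd_coef big_distrr /=.
apply: eq_bigr => j js; set l := inord _; have lE : index j (elist s.2) = l.
  by rewrite inordK // -cs index_elist.
have [p pE] := lift_permE P l; set r := [set m | lift l m \in R].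
have dE (c : bool) : deg (g \o ins (P l) c) t = (t == face s j (c (+) (l \in R)))%:R * ssgn p r.
  have gf x : g (ins (P l) c x) = vert (face s j (c (+) (l \in R))).1
      (face s j (c (+) (l \in R))).2 (sact p r x).
    by rewrite gE vert_face // -/l {1}pE sact_ins.
  have cf b : #|(face s j b).2| = q by exact: card_face.
  case: eqP => [->|tf]; first by rewrite mul1r; apply: deg_iso.
  rewrite mul0r; apply/eqP/negP=> /negP/deg_neq0[p' [r' h]]; apply: tf; apply/esym.
  apply: (vert_cube_eq (h := sact p r) (h' := sact p' r')) => //; try exact: sact_surj.
  by move=> x; rewrite -h -gf.
rewrite !dE lE -mulrBl {1}[P in ssgn P R]pE ssgn_lift -/r /face /=.
have -> : (-1) ^+ (P l).+1 = (-1) ^+ l.+1 * (-1) ^+ (l + P l) :> int.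
  by rewrite -exprD addSn addnA addnn !exprS exprD -mul2n exprM sqrrN !expr1n mul1r.
case: (l \in R); rewrite /= ?expr1 ?expr0; lia.
Qed.

End Cubes.

(** * Cancellation of faces *)

Lemma flip_diff q (k : 'I_q) x i : (flip k x i == x i) = (i != k).
Proof. by rewrite ffunE; case: (i == k); case: (x i). Qed.

Lemma flip_injl q (x : {ffun 'I_q -> bool}) k m : flip k x = flip m x -> k = m.
Proof.
move=> e; apply/eqP/negPn/negP=> km; have := flip_diff k x k; have := flip_diff m x k.
by rewrite -e eqxx km => ->.
Qed.

(** The graph of the cube is connected; the induction is on the number of coordinates in which [x]
    and [x0] differ. *)
Lemma flip_ind q (P : {ffun 'I_q -> bool} -> Prop) x0 :
  P x0 -> (forall x k, P x -> P (flip k x)) -> forall x, P x.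
Proof.
move=> P0 Pf x; have [m] := ubnP #|[set i | x i != x0 i]|; elim: m x => // m IH x.
case: (set_0Vmem [set i | x i != x0 i]) => [e _|[k]].
  suff -> : x = x0 by [].
  by apply/ffunP=> i; have /setP/(_ i) := e; rewrite !inE => /negbFE/eqP.
rewrite inE => xk lm; rewrite -(flipK k x); apply: Pf; apply: IH.
rewrite -ltnS; apply: leq_trans lm.
rewrite ltnS [X in (_ < X)%N](cardsD1 k) inE xk add1n ltnS subset_leq_card //.
apply/subsetP=> i; rewrite !inE; have [->|ik] := eqVneq i k.
  by rewrite ffunE eqxx; move: xk; case: (x k); case: (x0 k).
by rewrite ffunE (negPf ik) addbF.
Qed.

(** * Adjacency in coordinates *)

Section Near.
Variable n : nat.
Implicit Types (a u v y : pt n).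

Lemma ptDE u v k : (u + v) k = u k + v k.
Proof. by rewrite ffunE. Qed.

Lemma ptBE u v k : (u - v) k = u k - v k.
Proof. by rewrite !ffunE. Qed.

(* Adjacent or equal, in a form that can be used coordinatewise. *)
Definition near u v : Prop :=
  (forall i, `|u i - v i| <= 1) /\ (forall i j, i != j -> u i = v i \/ u j = v j).

Lemma near_sym u v : near u v -> near v u.
Proof.
case=> le1 one; split=> [i|i j ij]; first by rewrite distrC.
by case: (one i j ij) => ->; [left | right].
Qed.

Lemma c1adj_near u v : u = v \/ c1adj u v -> near u v.
Proof.
case=> [->|[i [uvi uv]]]; first by split=> *; [rewrite subrr | left].
split=> [j|j k jk].
  have [->|ji] := eqVneq j i; first by rewrite uvi.
  by rewrite uv ?subrr.
have [ji|ji] := eqVneq j i; last by left; apply: uv.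
by right; apply: uv; rewrite -ji eq_sym.
Qed.

(** [y] differs from [u] and from [v] in at most one coordinate each, which leaves only the other
    two corners of the rectangle spanned by [a], [u], [v]. *)
Lemma near_corner y a u v i j :
  i != j -> u i != a i -> v j != a j ->
  (forall k, k != i -> u k = a k) -> (forall k, k != j -> v k = a k) ->
  near y u -> near y v -> y = a \/ y = u + v - a.
Proof.
move=> ij ui vj uE vE [_ yu] [_ yv].
have ji : j != i by rewrite eq_sym.
have uj := uE _ ji; have vi := vE _ ij.
have yE k : k != i -> k != j -> y k = a k.
  move=> ki kj; have uk := uE _ ki; have vk := vE _ kj.
  case: (yu k i ki) => [->|e1]; first by [].
  case: (yv k i ki) => [->|e2]; first by [].
  by move: ui; rewrite -e1 e2 vi eqxx.
have [[e1 e2]|[e1 e2]] : (y i = a i /\ y j = a j) \/ (y i = u i /\ y j = v j).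
- case: (yu i j ij) => e1; case: (yv i j ij) => e2.
  + by move: ui; rewrite -e1 e2 vi eqxx.
  + by right.
  + by left; rewrite e1 e2.
  + by move: vj; rewrite -e2 e1 uj eqxx.
- left; apply/ffunP=> k; have [->//|ki] := eqVneq k i; have [->//|kj] := eqVneq k j.
  exact: yE.
- right; apply/ffunP=> k; rewrite !ffunE.
  have [->|ki] := eqVneq k i; first by rewrite e1 vi addrK.
  have [->|kj] := eqVneq k j; first by rewrite e2 uj addrC addKr.
  by rewrite uE // vE // yE // addrK.
Qed.

(** The lattice graph has no triangles. *)
Lemma near_edge y a u i :
  `|u i - a i| = 1 -> (forall k, k != i -> u k = a k) ->
  near y a -> near y u -> y = a \/ y = u.
Proof.
move=> ui uE [ya1 ya] [yu1 yu].
have yE k : k != i -> y k = a k.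
  move=> ki; case: (ya k i ki) => [//|e1]; case: (yu k i ki) => [->|e2]; first exact: uE.
  by move: ui; rewrite -e1 e2 subrr.
have [e|e] : y i = a i \/ y i = u i by have := ya1 i; have := yu1 i; lia.
  by left; apply/ffunP=> k; have [->|/yE] := eqVneq k i.
by right; apply/ffunP=> k; have [->//|ki] := eqVneq k i; rewrite uE // yE.
Qed.
End Near.

Definition iso_vert n q (t : cube n) (p : 'S_q) (r : {set 'I_q}) (x : {ffun 'I_q -> bool}) : pt n :=
  vert t.1 t.2 (sact p r x).

Section IsoVert.
Variables (n q : nat) (t : cube n) (p : 'S_q) (r : {set 'I_q}).
Hypothesis ct : #|t.2| = q.
Local Notation phi := (iso_vert t p r).

Lemma iso_vert_inj : injective phi.
Proof. by move=> x y /(vert_inj ct) /sact_inj. Qed.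

(** [J k] is the direction in which the image moves when coordinate [k] flips. Since [sact] puts
    coordinate [p m] in position [m], this direction has rank [p^-1 k] in [t]. *)
Lemma iso_vert_coords : exists (J : 'I_q -> 'I_n) (d : 'I_q -> bool),
  [/\ injective J, (forall j, j \in t.2 <-> exists k, j = J k),
      (forall x k, phi x (J k) = t.1 (J k) + (x k (+) d k : nat)%:Z)
    & forall x j, j \notin t.2 -> phi x j = t.1 j].
Proof.
have ex k : exists j, (j \in t.2) && (index j (elist t.2) == p^-1%g k).
  by have [j jt jk] := elist_nth (p^-1%g k) ct; exists j; rewrite jt jk eqxx.
pose J k := xchoose (ex k).
have Jt k : J k \in t.2 by case/andP: (xchooseP (ex k)).
have Jk k : index (J k) (elist t.2) = p^-1%g k by case/andP: (xchooseP (ex k)) => _ /eqP.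
have J_inj : injective J.
  by move=> k m e; apply: (@perm_inj _ p^-1%g); apply: val_inj; rewrite /= -!Jk e.
exists J, (fun k => p^-1%g k \in r); split=> //.
- move=> j; split=> [jt|[k ->]] //.
  have jq : (index j (elist t.2) < q)%N by rewrite -ct index_elist.
  exists (p (Ordinal jq)); rewrite -[LHS](nth_index j (s := elist t.2)) ?mem_elist //.
  by rewrite -[RHS](nth_index j (s := elist t.2)) ?mem_elist // Jk permK.
- by move=> x k; rewrite /iso_vert (vertE _ _ ct (Jt k) (Jk k)) ffunE permKV.
- by move=> x j jt; rewrite /iso_vert vert_out.
Qed.

Lemma iso_vert_flip : exists J : 'I_q -> 'I_n,
  [/\ injective J, (forall j, j \in t.2 <-> exists k, j = J k),
      (forall (x y : {ffun 'I_q -> bool}) k, x k != y k -> phi x (J k) != phi y (J k)),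
      (forall x k, `|phi (flip k x) (J k) - phi x (J k)| = 1)
    & forall x k j, j != J k -> phi (flip k x) j = phi x j].
Proof.
have [J [d [J_inj Jt phiJ phi_out]]] := iso_vert_coords; exists J; split=> //.
- by move=> x y k; rewrite !phiJ (inj_eq (addrI _)); case: (x k); case: (y k); case: (d k).
- move=> x k; rewrite !phiJ ffunE eqxx; case: (x k); case: (d k) => /=; lia.
- move=> x k j jk; case: (boolP (j \in t.2)) => [/Jt[m jm]|jt]; last by rewrite !phi_out.
  rewrite jm !phiJ ffunE; have [mk|_] := eqVneq m k; last by rewrite addbF.
  by rewrite jm mk eqxx in jk.
Qed.

Lemma near_iso_vert x y : near (phi x) (phi y) -> x = y \/ exists m, y = flip m x.
Proof.
have [J [J_inj _ Jdiff _ _]] := iso_vert_flip => -[_ one].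
have [->|xy] := eqVneq x y; first by left.
have [k xk] : exists k, x k != y k.
  by apply/existsP; apply: contraNT xy; rewrite negb_exists => /forallP e;
     apply/eqP/ffunP=> k; apply/eqP/negPn.
right; exists k; apply/ffunP=> m; rewrite ffunE; have [->|mk] := eqVneq m k.
  by move: xk; case: (x k); case: (y k).
rewrite addbF; apply/esym/eqP/negPn/negP=> xm.
have JJ : J m != J k by apply: contra mk => /eqP/J_inj ->.
by case: (one _ _ JJ) => /eqP; [move: (Jdiff _ _ _ xm) | move: (Jdiff _ _ _ xk)] => /negPf ->.
Qed.

End IsoVert.

(** * The faces mapped isomorphically onto a fixed cube *)

Section FaceCancel.
Variables (n q : nat) (t : cube n) (g : {ffun 'I_q.+1 -> bool} -> pt n).
Variables (i : 'I_q.+1) (c : bool) (p : 'S_q) (r : {set 'I_q}).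
Hypothesis q3 : (q <= 3)%N.
Hypothesis ct : #|t.2| = q.
Hypothesis gnear : forall x k, near (g x) (g (flip k x)).
Hypothesis noiso : ~ exists (s : cube n) P R, #|s.2| = q.+1 /\ forall x, g x = vert s.1 s.2 (sact P R x).
Local Notation phi := (iso_vert t p r).
Hypothesis gi : forall x, g (ins i c x) = phi x.
(** [g] on the facet opposite to the one that [phi] identifies with [t]. *)
Let g' x := g (ins i (~~ c) x).

Lemma g'_phi x : near (g' x) (phi x).
Proof. by rewrite -gi /g' ins_negb; apply/near_sym/gnear. Qed.

Lemma g'_flip x m : near (g' x) (g' (flip m x)).
Proof. by rewrite /g' ins_flip; apply: gnear. Qed.

(** Injectivity of [phi] makes the choice by [pick] unique. [None] covers [g' x = phi x] as well as
    values that are not vertices of [t]. *)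
Definition lab x : option 'I_q := [pick k | g' x == phi (flip k x)].

Lemma labP x k : reflect (g' x = phi (flip k x)) (lab x == Some k).
Proof.
apply: (iffP eqP); rewrite /lab; case: pickP => [m /eqP e|no].
- by case=> <-.
- by [].
- by rewrite e => /(iso_vert_inj ct)/flip_injl ->.
- by move/eqP; rewrite no.
Qed.

(** The value [g' (flip m x)] is near both [phi (flip k x)] and [phi (flip m x)], so by
    [near_corner] it is [phi x] or the opposite corner [phi (flip k (flip m x))]. *)
Lemma lab_edge1 x k m : lab x = Some k -> k != m ->
  lab (flip m x) = Some m \/ lab (flip m x) = Some k.
Proof.
have [J [J_inj _ _ J1 Jout]] := (iso_vert_flip p r ct).
move=> /eqP/labP g'x km.
have JJ : J k != J m by apply: contra km => /eqP/J_inj ->.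
have Jne x' k' : phi (flip k' x') (J k') != phi x' (J k').
  by rewrite -subr_eq0 -normr_eq0 J1.
have near1 := near_sym (g'_flip x m); rewrite g'x in near1.
case: (near_corner JJ (Jne x k) (Jne x m) (Jout x k) (Jout x m) near1 (g'_phi _)) => e.
  by left; apply/eqP/labP; rewrite e flipK.
right; apply/eqP/labP; rewrite e; apply/ffunP=> j; rewrite ptBE ptDE.
have [->|jk] := eqVneq j (J k).
  by rewrite flipC !(Jout _ m (J k)) // addrK.
by rewrite [phi (flip k (flip m x)) j]Jout // Jout // addrC addKr.
Qed.

Lemma lab_edge x m : lab x <> lab (flip m x) -> lab x = Some m \/ lab (flip m x) = Some m.
Proof.
case lx: (lab x) => [k|]; case ly: (lab (flip m x)) => [k'|] // ne.
- have [->|km] := eqVneq k m; first by left.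
  by case: (lab_edge1 lx km); rewrite ly => e; [right | rewrite e in ne].
- have [->|km] := eqVneq k m; first by left.
  by case: (lab_edge1 lx km); rewrite ly.
- have [->|km] := eqVneq k' m; first by right.
  by case: (lab_edge1 ly km); rewrite flipK lx.
Qed.

(* If the two faces differ by a translation, [g] is an isomorphism onto a cube. *)
Lemma g'_eq_phi : (forall x, lab x = None) -> forall x, g' x = phi x.
Proof.
move=> labN; have [J [J_inj Jt _ J1 Jout]] := (iso_vert_flip p r ct).
have g'N x k : g' x <> phi (flip k x) by move/labP; rewrite labN.
have [/existsP[x0 /eqP e0]|/existsPn ne] := boolP [exists x, g' x == phi x].
  (* Agreement spreads along edges: by [near_edge] the only alternative value is [phi x], which
     would be a label. *)
  apply: (flip_ind e0) => x m e.
  have near1 := near_sym (g'_flip x m); rewrite e in near1.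
  case: (near_edge (J1 x m) (Jout x m) near1 (g'_phi _)) => // e1.
  by case: (g'N (flip m x) m); rewrite flipK.
(* If [x] is neither [a] nor [f], it is the mirror image of [f] in [a]; then [a] is the only integer
   within distance 1 of both. *)
have mid (a f x y : int) : `|f - a| = 1 -> `|x - a| <= 1 -> `|y - f| <= 1 -> `|x - y| <= 1 ->
    x != a -> x != f -> y = a by lia.
have coord x : exists2 j, j \notin t.2 &
    `|g' x j - phi x j| = 1 /\ forall k, k != j -> g' x k = phi x k.
  have [j xj] : exists j, g' x j != phi x j.
    apply/existsP; apply: contraNT (ne x); rewrite negb_exists => /forallP e.
    by apply/eqP/ffunP=> k; apply/eqP/negPn.
  have [le1 one] := g'_phi x.
  have off k : k != j -> g' x k = phi x k.
    by move=> kj; case: (one k j kj) => // /eqP; rewrite (negPf xj).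
  exists j; last by split=> //; have := le1 j; lia.
  (* Were [j] a direction of [t], then [mid] would make [g' (flip m x)] equal to [phi x] and give
     [flip m x] the label [m]. *)
  apply/negP=> /Jt[m jm]; have e1 := J1 x m; rewrite -jm in e1.
  have e2 := le1 j.
  have g'f : g' x j != phi (flip m x) j.
    apply/negP=> /eqP e; case: (g'N x m); apply/ffunP=> k.
    have [->//|kj] := eqVneq k j; rewrite off // Jout //; by rewrite -jm.
  have [fb1 fbo] := g'_phi (flip m x); have [ff1 ffo] := g'_flip x m.
  have e3 := fb1 j; have e4 := ff1 j.
  case: (g'N (flip m x) m); rewrite flipK; apply/ffunP=> k.
  have [->|kj] := eqVneq k j; first by apply: (mid _ _ _ _ e1 e2 e3 e4 xj g'f).
  case: (fbo k j kj) => [->|e]; first by rewrite Jout // -jm.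
  exfalso; have := mid _ _ _ _ e1 e2 e3 e4 xj g'f; rewrite e => ef.
  by move: e1; rewrite ef subrr.
pose v x := g' x - phi x.
have vflip x m : v (flip m x) = v x.
  have [j jt [j1 joff]] := coord x.
  have jm : j != J m by apply: contra jt => /eqP ->; apply/Jt; exists m.
  have gj : g' x j != phi x j by rewrite -subr_eq0 -normr_eq0 j1.
  have pm : phi (flip m x) (J m) != phi x (J m) by rewrite -subr_eq0 -normr_eq0 J1.
  (* The corner [phi x] is excluded by the missing label, so the translation vector is the same at
     both ends of the edge. *)
  case: (near_corner jm gj pm joff (Jout x m) (near_sym (g'_flip x m)) (g'_phi _)) => e.
    by case: (g'N (flip m x) m); rewrite flipK.
  by rewrite /v e addrAC addrK.
pose x0 : {ffun 'I_q -> bool} := [ffun => false].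
have vE x : g' x = v x0 + phi x.
  have -> : v x0 = v x; last by rewrite subrK.
  by move: x; apply: flip_ind => // x m; rewrite vflip.
have [j jt [j1 joff]] := coord x0.
pose b := v x0 j < 0.
have voff k : k != j -> v x0 k = 0 by move=> kj; rewrite ptBE joff // subrr.
have v1 : v x0 j = if b then -1 else 1.
  by rewrite /b; move: j1; rewrite -ptBE -/(v x0); case: ifP; lia.
(* [b] tells whether the translation points down, in which case the base point of [s] lies one below
   that of [t]. *)
pose s : cube n := (if b then t.1 - unitv j else t.1, j |: t.2).
have js : j \in s.2 by rewrite !inE eqxx.
have cs : #|s.2| = q.+1 by rewrite cardsU1 jt ct.
have f2 b' : (face s j b').2 = t.2 by case: b'; rewrite /= setU1K.
have fb : face s j b = t.
  have f1 : (face s j b).1 = t.1 by rewrite /face /s; case: (b) => /=; rewrite ?subrK.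
  by move: (f2 b) f1; case: (face s j b) => a e /= -> ->; case: (t).
have fnb : (face s j (~~ b)).1 = v x0 + t.1.
  apply/ffunP=> k; rewrite ptDE; have [->|kj] := eqVneq k j.
    rewrite v1 /face /s; case: (b) => /=; rewrite ?ptBE ?ptDE ffunE eqxx; lia.
  rewrite voff // add0r /face /s.
  by case: (b) => /=; rewrite ?ptBE ?ptDE ffunE (negPf kj) ?addr0 ?subr0.
case: noiso; set l : 'I_q.+1 := inord (index j (elist s.2)).
(* The reflection at [l] is chosen to send the facet [z i = c] to the face [b] of [s], which is
   [t]. *)
pose R := [set m | if unlift l m is Some m' then m' \in r else c (+) b].
exists s, (lift_perm l i p), R; split=> // z; rewrite (insP i z) sact_ins.
have -> : [set m | lift l m \in R] = r by apply/setP=> m; rewrite !inE liftK.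
have -> : l \in R = c (+) b by rewrite inE unlift_none.
set x := [ffun m => z (lift i m)].
rewrite -vert_face //.
have [->|zc] := eqVneq (z i) c; first by rewrite addKb fb gi.
have -> : z i = ~~ c by move: zc; case: (z i); case: (c).
have -> : ~~ c (+) (c (+) b) = ~~ b by case: (c); case: (b).
rewrite -/(g' x) vE fnb f2; apply/ffunP=> k; rewrite ptDE.
by rewrite !ffunE addrA.
Qed.

Let w : int := ssgn p r.
Let dg l b : int := deg (g \o ins l b) t.

Lemma deg_face : dg i c = w.
Proof. exact: deg_iso. Qed.

Lemma deg_phi (h : {ffun 'I_q -> bool} -> pt n) p' r' :
  (forall x, h x = phi (sact p' r' x)) -> deg h t = w * ssgn p' r'.
Proof.
move=> hE; rewrite /w -ssgnM; apply: deg_iso => // x.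
by rewrite hE /iso_vert sactM.
Qed.

Definition facet_lab k b : bool := [forall x : {ffun 'I_q -> bool}, (x k == b) ==> (lab x == Some k)].

Lemma facet_labP k b :
  reflect (forall x : {ffun 'I_q -> bool}, x k = b -> g' x = phi (flip k x)) (facet_lab k b).
Proof.
apply: (iffP forallP) => [h x /eqP xk|h x].
  by apply/labP; have := h x; rewrite xk.
by apply/implyP=> /eqP /h/labP.
Qed.

(** The side facet is turned about its common ridge with the chosen face: on it, [g] equals [g]
    after the transposition of [i] and [lift i k], with both coordinates reflected if [b] differs
    from [c]. This signed permutation has sign -1. *)
Lemma deg_side_iso k b : facet_lab k b ->
  dg (lift i k) b = - w * (-1) ^+ (i + lift i k) * (-1) ^+ (b (+) c).
Proof.
move=> /facet_labP fl; set K := lift i k.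
have iK : i != K by exact: neq_lift.
pose R := if b (+) c then [set i; K] else set0.
have RE j : (j \in R) = ((j == i) || (j == K)) && (b (+) c).
  by rewrite /R; case: (b (+) c); rewrite !inE ?andbT ?andbF.
have cR : ssgn (tperm i K) R = -1.
  rewrite /ssgn odd_tperm iK /R; case: (b (+) c); rewrite ?cards2 ?iK ?cards0 //.
have [s sE] := lift_permE (tperm i K) i; rewrite tpermL in sE.
set R' := [set m | lift i m \in R].
have gE z : g (ins K b z) = phi (sact s R' z).
  have e1 : sact (tperm i K) R (ins K b z) = ins i c (sact s R' z).
    rewrite {1}sE sact_ins RE eqxx /=; congr (ins _ _ _); by case: (b); case: (c).
  rewrite -gi -e1; set y := ins K b z.
  have yK : y K = b by rewrite /y ins_id.
  have yE := insP i y; set x := [ffun m => _] in yE.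
  have xk : x k = b by rewrite ffunE.
  (* The turn fixes the ridge [y i = c]; elsewhere it lands on [ins i c (flip k x)], where the label
     gives the same value. *)
  have [yi|yi] := eqVneq (y i) c.
    congr g; apply/ffunP=> j; rewrite [RHS]ffunE RE.
    have [->|ji] := eqVneq j i; first by rewrite tpermL yK yi /=; case: (b); case: (c).
    have [->|jK] := eqVneq j K; first by rewrite tpermR yK yi /=; case: (b); case: (c).
    by rewrite tpermD 1?eq_sym // addbF.
  have {}yi : y i = ~~ c by move: yi; case: (y i); case: (c).
  rewrite {1}yE yi -/(g' x) fl // -gi ins_flip -/K; congr g; apply/ffunP=> j.
  rewrite [LHS]ffunE [RHS]ffunE RE.
  have [->|ji] := eqVneq j i.
    by rewrite tpermL yK ins_id (negPf iK) /=; case: (b); case: (c).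
  have [->|jK] := eqVneq j K.
    by rewrite tpermR yi /= ins_lift xk; case: (b); case: (c).
  rewrite tpermD 1?eq_sym // !addbF /=.
  case: (unliftP i j) ji => [m ->|->] ji; last by rewrite eqxx in ji.
  by rewrite ins_lift ffunE.
rewrite /dg (deg_phi gE).
have : ssgn (tperm i K) R = (-1) ^+ (i + K) * (-1) ^+ (b (+) c) * ssgn s R'.
  by rewrite {1}sE ssgn_lift RE eqxx.
rewrite cR -[(-1) ^+ (i + K)]signr_odd; set A := odd (i + K); set B := b (+) c.
by case: A; case: B; rewrite ?expr0 ?expr1 => e; lia.
Qed.

(** Some vertex of the side facet goes to [phi (flip k x)]. It is not on the ridge, as [phi] is
    injective, and nearness then forces it to lie over [x] in the opposite face. *)
Lemma deg_side_neq0 k b : dg (lift i k) b != 0 -> facet_lab k b.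
Proof.
move=> /deg_neq0[p' [r' h]]; apply/facet_labP=> x xk.
have [z zE] := sact_surj p' r' (sact p r (flip k x)).
have gz : g (ins (lift i k) b z) = phi (flip k x) by rewrite /iso_vert -zE -h.
set y := ins _ _ _ in gz.
have yK : y (lift i k) = b by rewrite /y ins_id.
have yE := insP i y; set x' := [ffun m => _] in yE.
have x'k : x' k = b by rewrite ffunE.
have [yi|yi] := eqVneq (y i) c.
  move: gz; rewrite yE yi gi => /(iso_vert_inj ct) e.
  by move: x'k; rewrite e ffunE eqxx xk; case: (b).
have {}yi : y i = ~~ c by move: yi; case: (y i); case: (c).
have g'x' : g' x' = phi (flip k x) by rewrite -gz yE yi.
have := near_sym (g'_phi x'); rewrite g'x' => /(near_iso_vert ct)[e|[m e]].
  by move: x'k; rewrite e ffunE eqxx xk; case: (b).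
have km : k = m.
  apply/eqP/negPn/negP=> km; have /ffunP/(_ k) := e.
  by rewrite [LHS]ffunE [RHS]ffunE eqxx (negPf km) xk x'k; case: (b).
have -> : x = x' by rewrite -(flipK k x) e -km flipK.
by rewrite g'x' e km.
Qed.

Lemma deg_side k b :
  dg (lift i k) b = - w * (-1) ^+ (i + lift i k) * (-1) ^+ (b (+) c) * (facet_lab k b)%:R.
Proof.
case: (boolP (facet_lab k b)) => [/deg_side_iso -> |fl]; first by rewrite mulr1.
by rewrite mulr0; apply/eqP; apply: contraNT fl => /deg_side_neq0.
Qed.

(** With the signs collected, every side facet mapped onto [t] counts against the chosen face, so
    besides the opposite face only a count of labelled facets remains. *)
Lemma bdeg_labels :
  bdeg g t = (-1) ^+ (i.+1 + c) *
    (w - dg i (~~ c) - w * \sum_k ((facet_lab k true)%:R + (facet_lab k false)%:R)).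
Proof.
have pairE l : deg (g \o ins l false) t - deg (g \o ins l true) t =
    (-1) ^+ c * (dg l c - dg l (~~ c)).
  by rewrite /dg; case: (c); rewrite /= ?expr0 ?expr1; lia.
have sideE k : (-1) ^+ (lift i k).+1 *
      (deg (g \o ins (lift i k) false) t - deg (g \o ins (lift i k) true) t) =
    - ((-1) ^+ (i.+1 + c) * (w * ((facet_lab k true)%:R + (facet_lab k false)%:R))).
  rewrite pairE !deg_side; move: (nat_of_ord (lift i k)) (facet_lab k) => K fl.
  rewrite exprS !exprD exprS -[(-1) ^+ i]signr_odd -[(-1) ^+ K]signr_odd.
  move: (odd i) (odd K) => a b.
  by case: a; case: b; case: (c); case: (fl true); case: (fl false);
     rewrite /= ?expr0 ?expr1; lia.
rewrite /bdeg (bigD1_ord i) //= pairE deg_face mulrA -exprD [RHS]mulrBr; congr (_ + _).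
rewrite (eq_bigr _ (fun k _ => sideE k)) sumrN -big_distrr /=.
by rewrite -big_distrr.
Qed.

(** Without labels the opposite face cancels the chosen one. A single labelled facet cancels it too,
    and the opposite face then has degree 0; if both facets in direction [k] are labelled, the
    opposite face is reflected and has degree [- w]. In a quarter turn no facet is labelled and the
    opposite face has degree [w]. *)
Lemma bdeg_eq0_face : bdeg g t = 0.
Proof.
suff: w - dg i (~~ c) - w * \sum_k ((facet_lab k true)%:R + (facet_lab k false)%:R) = 0.
  by rewrite bdeg_labels => ->; rewrite mulr0.
have fl0 : (forall k b, ~~ facet_lab k b) ->
    \sum_k ((facet_lab k true)%:R + (facet_lab k false)%:R) = 0 :> int.
  by move=> no; apply: big1 => k _; rewrite !(negPf (no _ _)).
have facet_ex k b : exists x : {ffun 'I_q -> bool}, x k = b.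
  by exists [ffun => b]; rewrite ffunE.
have fl_lab k b (x : {ffun 'I_q -> bool}) : facet_lab k b -> x k = b -> lab x = Some k.
  by move=> /facet_labP fl xk; apply/eqP/labP/fl.
case: (label_shapes q3 lab_edge) => [labN|[k [b fl]]|[k [m [km rot]]]].
- rewrite fl0 ?mulr0 ?subr0; last first.
    move=> k b; apply/negP=> /fl_lab fl; have [x xk] := facet_ex k b.
    by have := fl _ xk; rewrite labN.
  by rewrite /dg (deg_iso (p := p) (r := r)) ?subrr // => x; apply: g'_eq_phi.
- have flk : facet_lab k b by apply/facet_labP=> x /fl/eqP/labP.
  have flm m b' : m != k -> ~~ facet_lab m b'.
    move=> mk; apply/negP=> /fl_lab fl'; pose x : {ffun 'I_q -> bool} := [ffun j => if j == k then b else b'].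
    have xk : x k = b by rewrite ffunE eqxx.
    have xm : x m = b' by rewrite ffunE (negPf mk).
    by have := fl' _ xm; rewrite (fl _ xk) => -[km]; rewrite km eqxx in mk.
  rewrite (bigD1 k) //= big1 ?addr0; last by move=> m mk; rewrite !(negPf (flm _ _ mk)).
  (* The facet [b] already takes all values [phi u] with [u k = ~~ b], so an injective [g'] must
     send the other facet across too. *)
  have dnz : dg i (~~ c) != 0 -> facet_lab k (~~ b).
    move=> /deg_neq0[p' [r' h0]]; apply/facet_labP=> y yk.
    have h x : g' x = vert t.1 t.2 (sact p' r' x) by exact: h0.
    have [u uE] : exists u, g' y = phi u.
      have [u uE] := sact_surj p r (sact p' r' y).
      by exists u; rewrite /iso_vert uE -h.
    have g'_inj : injective g'.
      by move=> x x'; rewrite !h => /(vert_inj ct)/sact_inj.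
    have uk : u k = b.
      apply/eqP/negPn/negP=> uk.
      have fuk : flip k u k = b by rewrite ffunE eqxx; move: uk; case: (u k); case: (b).
      have /eqP/labP := fl _ fuk; rewrite flipK -uE => /g'_inj e.
      by move: yk; rewrite -e fuk; case: (b).
    have := near_sym (g'_phi y); rewrite uE => /(near_iso_vert ct)[e|[m e]].
      by move: yk; rewrite e uk; case: (b).
    have [km|mk] := eqVneq k m; first by rewrite e km.
    by move: uk; rewrite e ffunE (negPf mk) yk; case: (b).
  have [flk'|flk'] := boolP (facet_lab k (~~ b)); last first.
    have /eqP -> : dg i (~~ c) == 0 by apply: contraNT flk' => /dnz.
    by case: b flk flk' {fl dnz} => /= -> /negPf ->; rewrite mulr1 subr0 subrr.
  have -> : dg i (~~ c) = - w.
    rewrite /dg (@deg_phi _ 1%g [set k]); first by rewrite /ssgn odd_perm1 cards1 expr0 expr1 mul1r mulrN1.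
    move=> x; have -> : sact 1%g [set k] x = flip k x.
      by apply/ffunP=> j; rewrite !ffunE perm1 inE.
    have [xk|xk] := eqVneq (x k) b; first by apply/labP/eqP/fl.
    by move/facet_labP: flk'; apply; move: xk; case: (x k); case: (b).
  have -> : facet_lab k true by case: (b) flk flk'.
  have -> : facet_lab k false by case: (b) flk flk'.
  by rewrite /=; lia.
- rewrite fl0 ?mulr0 ?subr0; last first.
    move=> k' b; apply/negP=> /fl_lab fl.
    (* At these two vertices the label is [k] unless [k'] is [k] or [m], and then both labels
       occur. *)
    pose x b' : {ffun 'I_q -> bool} := [ffun j => if j == k' then b else b'].
    have xk' b' : x b' k' = b by rewrite ffunE eqxx.
    have := fl _ (xk' true); have := fl _ (xk' false); rewrite !rot !ffunE.
    have [kk'|kk'] := eqVneq k k'; have [mk'|mk'] := eqVneq m k'.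
    + by move: km; rewrite kk' mk' eqxx.
    + by case: (b) => /= -[e1] [e2]; case/eqP: mk'.
    + by case: (b) => /= -[e1] [e2]; case/eqP: kk'.
    + by case=> e1; move: kk'; rewrite e1 eqxx.
  (* A transposition with one reflection: the two signs -1 multiply to 1. *)
  rewrite /dg (@deg_phi _ (tperm k m) [set k]).
    by rewrite /ssgn odd_tperm km cards1 /= expr1 mulrNN !mulr1 subrr.
  move=> x; have /eqP/labP gx := rot x; rewrite -[LHS]/(g' x) gx.
  congr (phi _); apply/ffunP=> j; rewrite !ffunE inE.
  have [->|jk] := eqVneq j k.
    by rewrite tpermL; case: (x k); case: (x m); rewrite /= ?eqxx ?(negPf km).
  have [->|jm] := eqVneq j m.
    by rewrite tpermR; case: (x k); case: (x m); rewrite /= ?eqxx 1?eq_sym ?(negPf km).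
  rewrite tpermD; [|by rewrite eq_sym..].
  by case: ifP => _; rewrite ?(negPf jk) ?(negPf jm).
Qed.
End FaceCancel.

(** * The trace formula *)

Lemma bdeg_eq0 n q (t : cube n) (g : {ffun 'I_q.+1 -> bool} -> pt n) :
  (q <= 3)%N -> #|t.2| = q -> (forall x k, near (g x) (g (flip k x))) ->
  ~ (exists (s : cube n) P R, #|s.2| = q.+1 /\ forall x, g x = vert s.1 s.2 (sact P R x)) ->
  bdeg g t = 0.
Proof.
move=> q3 ct gnear noiso.
have [/existsP[i /existsP[c /deg_neq0[p [r gi]]]]|no] :=
  boolP [exists i, exists c, deg (g \o ins i c) t != 0].
  exact: bdeg_eq0_face gi.
apply: big1 => l _; suff d0 c : deg (g \o ins l c) t = 0 by rewrite !d0 subrr mulr0.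
by apply/eqP; apply: contraNT no => d; apply/existsP; exists l; apply/existsP; exists c.
Qed.

Lemma vert_near n q (X : {fset pt n}) (f : pt n -> pt n) (s : cube n) :
  c1_continuous X f -> s \in cubes X q ->
  forall (x : {ffun 'I_q -> bool}) k,
    near (f (vert s.1 s.2 x)) (f (vert s.1 s.2 (flip k x))).
Proof.
move=> fc /cubesP[cs sX] x k; apply: c1adj_near; apply: fc => //.
have [J [_ _ _ J1 Jout]] := iso_vert_flip 1%g set0 cs.
have s1 y : sact 1%g set0 y = y :> {ffun 'I_q -> bool}.
  by apply/ffunP=> j; rewrite !ffunE perm1 inE addbF.
exists (J k); split=> [|j jk].
  by have := J1 x k; rewrite /iso_vert !s1 distrC.
by have := Jout x k j jk; rewrite /iso_vert !s1.
Qed.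

Section Lefschetz.
Variables (n : nat) (X : {fset pt n}) (f : pt n -> pt n).
Hypothesis n4 : (n <= 4)%N.
Hypothesis fX : forall x, x \in X -> f x \in X.
Hypothesis fc : c1_continuous X f.

(** If some coefficient is nonzero, [f] maps [s] isomorphically onto that one cube and signs are
    compared; otherwise both sides vanish, the right one by cancellation of faces. *)
Lemma chain_map_coef q (s t : cube n) : s \in cubes X q.+1 -> t \in cubes X q ->
  \sum_(r <- cubes X q.+1) fcoef f q.+1 s r * bd_coef r t =
  \sum_(r <- cubes X q) bd_coef s r * fcoef f q r t.
Proof.
move=> sX /cubesP[ct _]; have [cs sX'] := cubesP _ _ _ sX.
rewrite sum_bd_fcoef //; set g := fun x : {ffun 'I_q.+1 -> bool} => f _.
have fE (r : cube n) : #|r.2| = q.+1 -> fcoef f q.+1 s r = deg g r by move=> cr; rewrite fcoefE cs cr eqxx.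
have [/hasP[r rX]|/hasPn no] := boolP (has (fun r => fcoef f q.+1 s r != 0) (cubes X q.+1)).
  have [cr _] := cubesP _ _ _ rX; rewrite fE // => /deg_neq0[P [R gE]].
  rewrite (bdeg_iso cr ct gE) (bigD1_seq r) ?cubes_uniq //= fE // (deg_iso cr gE).
  rewrite big1_seq ?addr0 // => r' /andP[r'r r'X].
  have [cr' _] := cubesP _ _ _ r'X; rewrite fE //.
  suff /eqP -> : deg g r' == 0 by rewrite mul0r.
  apply: contraNT r'r => /deg_neq0[P' [R' gE']]; apply/eqP.
  apply: (vert_cube_eq (h := sact P' R') (h' := sact P R)) => //; try exact: sact_surj.
  by move=> x; rewrite -gE -gE'.
rewrite big1_seq; last first.
  by move=> r /andP[_ rX]; have := no _ rX; rewrite negbK => /eqP ->; rewrite mul0r.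
(* A cube of dimension [q.+1] exists, so [q.+1 <= n <= 4]. *)
apply/esym/bdeg_eq0 => //; first by have := max_card (mem s.2); rewrite cs card_ord; lia.
  exact: (vert_near fc sX).
move=> [r [P [R [cr gE]]]].
(* The image cube lies in [X], so it would have occurred in the left-hand sum. *)
have rX : r \in cubes X q.+1.
  apply/cubesP; split=> // y; have [x <-] := sact_surj P R y.
  by rewrite -gE; apply: fX.
have := no _ rX; rewrite fE // (deg_iso cr gE) negbK => /eqP e.
by have := ssgn_sq P R; rewrite e mul0r.
Qed.

Lemma chain_map q : chainmx X f q.+1 *m bdmx X q = bdmx X q *m chainmx X f q.
Proof.
apply/matrixP=> i j; rewrite !mxE.
under eq_bigr do rewrite !mxE -intrM.
under [RHS]eq_bigr do rewrite !mxE -intrM.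
rewrite -!rmorph_sum /=; congr (_%:~R).
rewrite (sum_cubes X _ (fun r => fcoef f q.+1 (cube_at i) r * bd_coef r (cube_at j))).
rewrite (sum_cubes X _ (fun r => bd_coef (cube_at i) r * fcoef f q r (cube_at j))).
by rewrite chain_map_coef ?cube_at_in.
Qed.

Lemma bdmx_bdmx q : bdmx X q.+1 *m bdmx X q = 0.
Proof.
apply/matrixP=> i j; rewrite !mxE.
under eq_bigr do rewrite !mxE -intrM.
rewrite -rmorph_sum /= (sum_cubes X _ (fun r => bd_coef (cube_at i) r * bd_coef r (cube_at j))).
by rewrite sum_bd_coef2 ?cube_at_in.
Qed.

Lemma bdmx_stable q : (bdmx X q *m chainmx X f q <= bdmx X q)%MS.
Proof. by rewrite -chain_map submxMl. Qed.

(** The trace of the chain map on the [q]-boundaries. *)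
Let b q := im_trace (chainmx X f q) (bdmx X q).

Lemma trace_chainmx0 : \tr (chainmx X f 0) = hom_trace X f 0 + b 0.
Proof.
rewrite /hom_trace -(trace_split (E := 1%:M)) ?mulmx1 ?submx1 //.
exact: bdmx_stable.
Qed.

Lemma trace_chainmxS q : \tr (chainmx X f q.+1) = hom_trace X f q.+1 + b q.+1 + b q.
Proof.
apply: trace_kernel_split; [exact: bdmx_bdmx | exact: chain_map | exact: bdmx_stable].
Qed.

(** Each [b q] occurs in degrees [q] and [q.+1] with opposite signs, so the sum telescopes. *)
Lemma sum_trace_chainmx m :
  \sum_(q < m.+1) (-1) ^+ q * \tr (chainmx X f q) =
  \sum_(q < m.+1) (-1) ^+ q * hom_trace X f q + (-1) ^+ m * b m.
Proof.
elim: m => [|m IH]; first by rewrite !big_ord1 trace_chainmx0 mulrDr.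
rewrite big_ord_recr IH [in RHS]big_ord_recr /= trace_chainmxS exprS !mulrDr.
by rewrite mulN1r !mulNr -!addrA; congr (_ + _); rewrite addrCA; congr (_ + _);
   rewrite addrCA subrr addr0.
Qed.

Lemma lefschetz_trace : lefschetz X f = \sum_(q < n.+1) (-1) ^+ q * \tr (chainmx X f q).
Proof.
rewrite sum_trace_chainmx /b /im_trace.
(* No cube has dimension [n.+1], so the matrix has no rows and the last term vanishes. *)
have -> : bdmx X n = 0.
  apply/matrixP=> i; have /cubesP[ci _] := cube_at_in i.
  by have := max_card (mem (cube_at i).2); rewrite ci card_ord ltnn.
by rewrite !mulmx0 mxtrace0 mulr0 addr0.
Qed.

Lemma fcoef_fixed q (s : cube n) : fcoef f q s s != 0 -> map f (verts s) =i verts s.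
Proof.
rewrite fcoefE andbb; case: ifP => [/eqP cs|_]; last by rewrite eqxx.
(* [verts] is indexed by functions on ['I_#|s.2|], so [q] is replaced by [#|s.2|]. *)
case: q / cs => /deg_neq0[p [r fE]] v; apply/mapP/mapP => [[u]|[y _ ->]].
  by case/mapP=> x _ -> ->; exists (sact p r x); rewrite ?mem_enum.
have [x <-] := sact_surj p r y; exists (vert s.1 s.2 x); last by rewrite fE.
by apply: map_f; rewrite mem_enum.
Qed.

End Lefschetz.

Theorem theorem4p3 (n : nat) (X : {fset pt n}) (f : pt n -> pt n) :
  (n <= 4)%N ->
  (forall x, x \in X -> f x \in X) ->
  c1_continuous X f ->
  lefschetz X f != 0%R ->
  exists s : cube n,
    all (fun v => v \in X) (verts s) /\ map f (verts s) =i verts s.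
Proof.
move=> n4 fX fc; rewrite lefschetz_trace // => L0.
have [q trq] : exists q : 'I_n.+1, \tr (chainmx X f q) != 0.
  apply/existsP; apply: contraNT L0; rewrite negb_exists => /forallP no.
  by rewrite big1 // => q _; have := no q; rewrite negbK => /eqP ->; rewrite mulr0.
have [i ci] : exists i, chainmx X f q i i != 0.
  apply/existsP; apply: contraNT trq; rewrite negb_exists => /forallP no.
  by rewrite /mxtrace big1 // => i _; apply/eqP/negPn.
have [cs sX] := cubesP _ _ _ (cube_at_in i); exists (cube_at i); split.
  by apply/vertsP; rewrite cs.
by apply: (fcoef_fixed (q := q)); move: ci; rewrite mxE intr_eq0.
Qed.
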